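(* Over any field, abelian diagonalizable Lie algebra conjugacy is GI-hard; that is, the graph isomorphism problem reduces in polynomial time to the Lie algebra conjugacy problem restricted to abelian diagonalizable matrix Lie algebras (of unbounded dimension).
   Context: A matrix Lie algebra over a field $\mathbb{F}$ is a linear subspace $\mathcal{L}$ of the $n\times n$ matrices over $\mathbb{F}$ closed under $[A,B]:=AB-BA$. It is abelian if all its matrices commute pairwise, and diagonalizable if it is conjugate to a set of diagonal matrices, i.e. $A\mathcal{L}A^{-1}$ consists of diagonal matrices for some invertible $A$. Lie Algebra Conjugacy (LAC): given two Lie algebras $\mathcal{L}_1,\mathcal{L}_2$ of $n\times n$ matrices, each by a linear basis, output an invertible $n\times n$ matrix $A$ with $A\mathcal{L}_1A^{-1}=\mathcal{L}_2$ if such $A$ exists, and otherwise report that they are not conjugate. GI denotes the graph isomorphism problem: given two finite graphs, decide whether they are isomorphic. *)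

(* Defs.v *)
From HB Require Import structures.
From mathcomp Require Import all_boot all_order all_algebra.

Set Implicit Arguments.
Unset Strict Implicit.
Unset Printing Implicit Defensive.

Import GRing.Theory.
Local Open Scope ring_scope.

(* Strings are over a fixed six-letter alphabet: two bits and four
   delimiters, so that nested lists have a uniquely readable encoding. *)
Inductive symbol := Bit of bool | Comma | Semi | Bar | Slash.

Definition word := seq symbol.

(* s1 ++ [:: d] ++ s2 ++ [:: d] ++ ... ++ sk ++ [:: d] *)
Definition terminate (d : symbol) (ss : seq word) : word :=
  flatten [seq rcons s d | s <- ss].

(* A tape cell is blank (None), or holds an input/output symbol, or a symbol
   of the machine's own finite work alphabet. *)
Definition cell (W : Type) := option (symbol + W)%type.

Inductive move := MoveLeft | Stay | MoveRight.

Definition shift (m : move) : int :=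
  match m with MoveLeft => -1 | Stay => 0 | MoveRight => 1 end.

(* There are at least two tapes: tape ord0 holds the input at the start, tape
   ord_max holds the output at the end. *)
Record machine := Machine {
  state : finType;
  work : finType;
  extra_tapes : nat;
  start : state;
  halted : pred state;
  trans : state -> {ffun 'I_extra_tapes.+2 -> cell work} ->
          state * {ffun 'I_extra_tapes.+2 -> cell work * move}
}.

(* Tapes are two-way infinite. *)
Record config (M : machine) := Config {
  cstate : state M;
  chead : 'I_(extra_tapes M).+2 -> int;
  ctape : 'I_(extra_tapes M).+2 -> int -> cell (work M)
}.

Definition step (M : machine) (c : config M) : config M :=
  if halted (cstate c) then c else
  let: (q, act) :=
    trans (cstate c) [ffun i => ctape c i (chead c i)] in
  Config q
    (fun i => chead c i + shift (act i).2)
    (fun i z => if z == chead c i then (act i).1 else ctape c i z).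

(* The word w written in cells 0, 1, ..., on an otherwise blank tape. *)
Definition tape_of (W : Type) (w : word) (z : int) : cell W :=
  match z with
  | Posz i => nth None [seq Some (inl a) | a <- w] i
  | Negz _ => None
  end.

Definition init (M : machine) (w : word) : config M :=
  Config (start M) (fun=> 0)
    (fun i => if i == ord0 then tape_of (work M) w else fun=> None).

Definition outputs_within (M : machine) (w v : word) (t : nat) : Prop :=
  exists2 s : nat, (s <= t)%N &
    let c := iter s (@step M) (init M w) in
    halted (cstate c) /\ ctape c ord_max =1 tape_of (work M) v.

Record decision_problem := DecisionProblem {
  dinst : Type;
  dcode : word -> dinst -> Prop; (* the word represents the instance *)
  dyes : dinst -> Prop
}.

(* "Output a solution if there is one, otherwise report that there is none",
   on instances satisfying the promise. *)
Record search_problem := SearchProblem {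
  sinst : Type;
  scode : word -> sinst -> Prop;
  spromise : sinst -> Prop;
  scand : sinst -> Type;
  ssol : forall y : sinst, scand y -> Prop
}.

Definition correct_answer (Q : search_problem) (y : sinst Q)
    (ans : option (scand y)) : Prop :=
  match ans with
  | Some a => ssol a
  | None => forall a : scand y, ~ ssol a
  end.

Definition polytime_computable (I J : Type) (codeI : word -> I -> Prop)
    (codeJ : word -> J -> Prop) (f : I -> J) : Prop :=
  exists (M : machine) (p : {poly nat}), forall (x : I) (w : word),
    codeI w x ->
    exists2 v : word, codeJ v (f x) & outputs_within M w v p.[size w].

(* Many-one reduction: x is a yes-instance exactly when a correct solver for Q
   returns a solution, rather than reporting that there is none, on f x. *)
Definition polytime_reduces (P : decision_problem) (Q : search_problem) : Prop :=
  exists2 f : dinst P -> sinst Q,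
    polytime_computable (@dcode P) (@scode Q) f &
    forall x : dinst P, spromise (f x) /\
      forall ans : option (scand (f x)), correct_answer ans ->
        (dyes x <-> isSome ans).

Record graph := Graph {
  order : nat;
  adj : rel 'I_order;
  adj_sym : symmetric adj;
  adj_irrefl : irreflexive adj
}.

Definition graph_iso (G H : graph) : Prop :=
  exists2 f : 'I_(order G) -> 'I_(order H), bijective f &
    forall x y : 'I_(order G), adj (f x) (f y) = adj x y.

Definition graph_word (G : graph) : word :=
  terminate Semi
    [seq [seq Bit (adj x y) | y <- enum 'I_(order G)] | x <- enum 'I_(order G)].

Definition GI : decision_problem :=
  @DecisionProblem (graph * graph)
    (fun w GH => w = terminate Slash [:: graph_word GH.1; graph_word GH.2])
    (fun GH => graph_iso GH.1 GH.2).

Section MatrixLie.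
Variables (F : fieldType) (n : nat).
Implicit Types L : {vspace 'M[F]_n}.

Definition lie_bracket (A B : 'M[F]_n) : 'M[F]_n := A *m B - B *m A.

Definition is_lie_algebra L : Prop :=
  {in L &, forall A B, lie_bracket A B \in L}.

Definition lie_abelian L : Prop := {in L &, forall A B, comm_mx A B}.

Definition lie_diagonalizable L : Prop :=
  exists2 A : 'M[F]_n, A \in unitmx &
    {in L, forall X, is_diag_mx (A *m X *m invmx A)}.

(* A L1 A^-1 = L2, as sets of matrices *)
Definition conjugates (A : 'M[F]_n) L1 L2 : Prop :=
  A \in unitmx /\
  forall Y : 'M[F]_n,
    Y \in L2 <-> exists2 X : 'M[F]_n, X \in L1 & Y = A *m X *m invmx A.

End MatrixLie.

Record lac_instance (F : fieldType) := LacInstance {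
  lac_size : nat;
  lac_basis1 : seq 'M[F]_lac_size;
  lac_basis2 : seq 'M[F]_lac_size
}.

Definition lac_alg1 (F : fieldType) (y : lac_instance F) := <<lac_basis1 y>>%VS.
Definition lac_alg2 (F : fieldType) (y : lac_instance F) := <<lac_basis2 y>>%VS.

Definition matrix_word (n : nat) (C : 'M[seq bool]_n) : word :=
  terminate Semi
    [seq terminate Comma [seq [seq Bit b | b <- C i j] | j <- enum 'I_n]
    | i <- enum 'I_n].

(* Field elements are represented by bit strings: rep s is the element denoted
   by s, if any. An element may have several representations, or (necessarily
   so when F is uncountable) none. An instance is written as its size in
   unary, then the two bases. *)
Definition lac_code (F : fieldType) (rep : seq bool -> option F)
    (w : word) (y : lac_instance F) : Prop :=
  exists C1 C2 : seq 'M[seq bool]_(lac_size y),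
    [/\ [seq map_mx rep C | C <- C1] = [seq map_mx Some B | B <- lac_basis1 y],
        [seq map_mx rep C | C <- C2] = [seq map_mx Some B | B <- lac_basis2 y] &
        w = terminate Slash
              [:: nseq (lac_size y) (Bit true);
                  terminate Bar [seq matrix_word C | C <- C1];
                  terminate Bar [seq matrix_word C | C <- C2]]].

Definition abelian_diagonalizable_basis (F : fieldType) (n : nat)
    (B : seq 'M[F]_n) : Prop :=
  [/\ free B, is_lie_algebra <<B>>%VS, lie_abelian <<B>>%VS
    & lie_diagonalizable <<B>>%VS].

Definition abelian_diagonalizable_LAC (F : fieldType)
    (rep : seq bool -> option F) : search_problem :=
  @SearchProblem (lac_instance F) (lac_code rep)
    (fun y => abelian_diagonalizable_basis (lac_basis1 y) /\
              abelian_diagonalizable_basis (lac_basis2 y))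
    (fun y => 'M[F]_(lac_size y))
    (fun y A => conjugates A (lac_alg1 y) (lac_alg2 y)).

Definition GI_hard (Q : search_problem) : Prop := polytime_reduces GI Q.

(* Main.v *)
(* Give the cells of the input word weights in F^n, n the number of vertices of a
   graph: the cell (x, y) of its adjacency matrix has weight e_x if x = y,
   e_x + e_y if xy is an edge, and 0 otherwise; all other cells, including those
   of the other graph, have weight 0. The diagonal matrices X_u carrying the u-th
   coordinates of all weights span the Lie algebra of the graph. A matrix A
   conjugating one such algebra to another is invertible, so some term of the
   Leibniz formula for its determinant is nonzero; comparing entries of
   A X = Y A along that term gives a bijection between the cells and a linear map
   that carries the weights of one graph to those of the other. The vertices are
   recognizable as the nonzero weights of multiplicity one, since edges have
   multiplicity two; hence the linear map permutes the e_x and respects edges.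

   The bases are written by a machine that sweeps over its input from left to
   right, each sweep being a finite-state transduction: the row and the column of
   the current vertex, and the current position on the diagonal, are marked on
   the tape and shifted by one between sweeps. *)
From HB Require Import structures.
From mathcomp Require Import all_boot all_order all_algebra fingroup perm zify.
Require Import Defs.

Set Implicit Arguments.
Unset Strict Implicit.
Unset Printing Implicit Defensive.

Import GRing.Theory.
Local Open Scope ring_scope.

(** * Conjugacy of algebras of diagonal matrices *)

Section DiagonalAlgebras.

Variable F : fieldType.

(* The columns of the N x n matrix W span the algebra; its rows are the n-tuples
   of simultaneous eigenvalues, called weights below. *)
Definition diag_basis (N n : nat) (W : 'M[F]_(N, n)) : seq 'M[F]_N :=
  [seq diag_mx (col u W)^T | u <- enum 'I_n].

Lemma diag_basisE N n (W : 'M[F]_(N, n)) :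
  diag_basis W = [tuple diag_mx (col u W)^T | u < n].
Proof. by []. Qed.

Lemma sum_diag_basis N n (W : 'M[F]_(N, n)) (a : 'cV_n) :
  \sum_(u < n) a u 0 *: (diag_basis W)`_u = diag_mx (W *m a)^T.
Proof.
rewrite trmx_mul mulmx_sum_row raddf_sum; apply: eq_bigr => u _ /=.
by rewrite linearZ /= diag_basisE -tnth_nth tnth_mktuple mxE tr_col.
Qed.

Lemma span_diag_basisP N n (W : 'M[F]_(N, n)) (X : 'M_N) :
  reflect (exists a : 'cV_n, X = diag_mx (W *m a)^T) (X \in <<diag_basis W>>%VS).
Proof.
apply: (iffP idP) => [|[a ->]].
  rewrite diag_basisE => /coord_span ->.
  exists (\col_u coord [tuple diag_mx (col u W)^T | u < n] u X).
  by rewrite -sum_diag_basis; apply: eq_bigr => u _; rewrite mxE.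
rewrite -sum_diag_basis; apply: memv_suml => u _; apply/memvZ/memv_span.
by rewrite mem_nth // size_map size_enum_ord.
Qed.

(** Where the row of [W] is e_u, the diagonal entry of a combination of the basis is its u-th
    coefficient; this gives freeness. *)
Lemma diag_basis_abelian_diagonalizable N n (W : 'M[F]_(N, n)) :
    (forall u, exists i, row i W = delta_mx 0 u) ->
  abelian_diagonalizable_basis (diag_basis W).
Proof.
move=> Wdelta.
have ab : lie_abelian <<diag_basis W>>%VS.
  by move=> _ _ /span_diag_basisP[a ->] /span_diag_basisP[b ->]; apply: diag_mxC.
split=> //.
- rewrite diag_basisE; apply/freeP => k k0 u.
  have [i /rowP Wi] := Wdelta u.
  have {}Wi v : W i v = (v == u)%:R by have := Wi v; rewrite !mxE.
  have := sum_diag_basis W (\col_u k u).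
  under eq_bigr do rewrite mxE.
  rewrite diag_basisE k0 => /(congr1 (fun X : 'M_N => X i i)).
  rewrite !mxE eqxx mulr1n (bigD1 u) //= big1 => [|v vu].
    by rewrite !mxE Wi eqxx mul1r addr0.
  by rewrite Wi (negPf vu) mul0r.
- by move=> X Y X_in Y_in; rewrite /lie_bracket ab // subrr mem0v.
- exists 1%:M; first exact: unitmx1.
  move=> _ /span_diag_basisP[a ->].
  by rewrite invmx1 mul1mx mulmx1 diag_mx_is_diag.
Qed.

(* Some term of the Leibniz formula for \det A is nonzero. *)
Lemma unitmx_perm_support n (A : 'M[F]_n) :
  A \in unitmx -> exists s : 'S_n, forall i, A i (s i) != 0.
Proof.
rewrite unitmxE unitfE => detA.
have [s As|A0] := pickP (fun s : 'S_n => \prod_i A i (s i) != 0).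
  by exists s => i; move/prodf_neq0: As; apply.
by case/eqP: detA; apply: big1 => s _; move/negbFE/eqP: (A0 s) => ->; rewrite mulr0.
Qed.

(** [C] and [D] express that, up to a permutation of the rows, [W] and [Z] have the same column
    space. For the converse, a permutation matrix conjugates. *)
Lemma conjugates_diag_basisP N n m (W : 'M[F]_(N, n)) (Z : 'M[F]_(N, m)) :
  (exists A, conjugates A <<diag_basis W>>%VS <<diag_basis Z>>%VS) <->
  exists s : 'S_N, exists C : 'M_(m, n), exists D : 'M_(n, m),
    W = row_perm s Z *m C /\ row_perm s Z = W *m D.
Proof.
split=> [[A [uA AWZ]]|[s [C [D [WZ ZW]]]]].
  have [s As] : exists s : 'S_N, forall i, A (s i) i != 0.
    have [s As] := unitmx_perm_support uA.
    by exists (s^-1)%g => i; have := As (s^-1 i)%g; rewrite permKV.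
  (* Compare the entries (s i, i) of A X = Y A and cancel the nonzero [A (s i) i]. *)
  have eigen X Y : A *m diag_mx X^T *m invmx A = diag_mx Y^T ->
      forall i, Y (s i) 0 = X i 0.
    move=> /(congr1 (mulmx^~ A)); rewrite mulmxKV // mul_mx_diag mul_diag_mx.
    move=> /matrixP AXY i; move: (AXY (s i) i); rewrite !mxE mulrC.
    by move/(mulIf (As i)).
  have colW u : exists b : 'cV_m, A *m diag_mx (col u W)^T *m invmx A = diag_mx (Z *m b)^T.
    apply/span_diag_basisP/AWZ; eexists; last reflexivity.
    by apply/memv_span/map_f; rewrite mem_enum.
  have colZ u : exists a : 'cV_n, A *m diag_mx (W *m a)^T *m invmx A = diag_mx (col u Z)^T.
    have /AWZ[_ /span_diag_basisP[a ->] ->] : diag_mx (col u Z)^T \in <<diag_basis Z>>%VS.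
      by apply/memv_span/map_f; rewrite mem_enum.
    by exists a.
  have [b bP] := fin_all_exists colW; have [a aP] := fin_all_exists colZ.
  exists s, (\matrix_(v, u) b u v 0), (\matrix_(u, v) a v u 0).
  split; apply/matrixP => i u; rewrite [RHS]mxE.
    have := eigen _ _ (bP u) i; rewrite !mxE => <-.
    by apply: eq_bigr => v _; rewrite !mxE.
  have := eigen _ _ (aP u) i; rewrite !mxE => ->.
  by apply: eq_bigr => v _; rewrite !mxE.
have uP : perm_mx s^-1 \in unitmx := unitmx_perm F s^-1.
have conj (d e : 'cV[F]_N) : d = row_perm s e ->
    perm_mx s^-1 *m diag_mx d^T *m invmx (perm_mx s^-1) = diag_mx e^T.
  move=> ->; rewrite -[RHS](mulmxK uP); congr (_ *m _).
  rewrite mul_diag_mx mul_mx_diag; apply/matrixP => i j; rewrite !mxE.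
  have [<-|_] := eqVneq ((s^-1)%g i) j; last by rewrite mul0r mulr0.
  by rewrite permKV mulrC.
have rowM p (Y : 'M_(N, p)) q (B : 'M_(p, q)) : row_perm s (Y *m B) = row_perm s Y *m B.
  by rewrite !row_permE mulmxA.
exists (perm_mx s^-1); split=> // Y; split.
  move=> /span_diag_basisP[b ->]; exists (diag_mx (W *m (D *m b))^T).
    by apply/span_diag_basisP; exists (D *m b).
  by rewrite (conj _ (Z *m b)) // rowM ZW mulmxA.
case=> _ /span_diag_basisP[a ->] ->; apply/span_diag_basisP; exists (C *m a).
by rewrite (conj _ (Z *m (C *m a))) // rowM mulmxA -WZ.
Qed.

End DiagonalAlgebras.

(** * Weights of a graph *)

Section GraphWeights.

Variable F : fieldType.

(** The disjunction makes [pair_weight x x] equal to e_x; the sum e_x + e_x would vanish in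
    characteristic two. *)
Definition pair_weight n (x y : 'I_n) : 'rV[F]_n :=
  \row_u ((u == x) || (u == y))%:R.

Definition graph_weight (G : graph) (p : 'I_(order G) * 'I_(order G)) :=
  if adj p.1 p.2 || (p.1 == p.2) then pair_weight p.1 p.2 else 0.

(* A vertex x has weight e_x with multiplicity one, an edge xy has weight
   e_x + e_y with multiplicity two, and no other nonzero weight occurs. *)
Definition weight_matrix_of (G : graph) N (W : 'M[F]_(N, order G)) :=
  exists k, perm_eq [seq row i W | i <- enum 'I_N]
                    ([seq graph_weight p | p <- enum predT] ++ nseq k 0).

Lemma pair_weightE n (x y u : 'I_n) :
  pair_weight x y 0 u = ((u == x) || (u == y))%:R.
Proof. by rewrite mxE. Qed.

Lemma pair_weight_neq0 n (x y : 'I_n) : pair_weight x y != 0.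
Proof.
apply/eqP => /rowP/(_ x); rewrite pair_weightE eqxx mxE.
by move/eqP; rewrite oner_eq0.
Qed.

Lemma pair_weightC n (x y : 'I_n) : pair_weight x y = pair_weight y x.
Proof. by apply/rowP => u; rewrite !pair_weightE orbC. Qed.

Lemma pair_weight_inj n (x y x' y' : 'I_n) : pair_weight x y = pair_weight x' y' ->
  (x = x' /\ y = y') \/ (x = y' /\ y = x').
Proof.
move=> exy; have {}exy u : (u == x) || (u == y) = (u == x') || (u == y').
  have /rowP/(_ u) := exy; rewrite !pair_weightE => /eqP.
  by case: (_ || _) (_ || _) => [] []; rewrite ?oner_eq0 // eq_sym oner_eq0.
have /orP hx : (x == x') || (x == y') by rewrite -exy eqxx.
have /orP hy : (y == x') || (y == y') by rewrite -exy eqxx orbT.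
have /orP hx' : (x' == x) || (x' == y) by rewrite exy eqxx.
have /orP hy' : (y' == x) || (y' == y) by rewrite exy eqxx orbT.
case: hx => /eqP ?; subst; [left|right]; split=> //.
  by case: hy => /eqP // ?; subst; case: hy' => /eqP.
by case: hy => /eqP // ?; subst; case: hx' => /eqP.
Qed.

Lemma pair_weight_diag n (x : 'I_n) : pair_weight x x = delta_mx 0 x.
Proof. by apply/rowP => u; rewrite pair_weightE !mxE eqxx orbb. Qed.

Lemma pair_weight_sum n (x y : 'I_n) : x != y ->
  pair_weight x y = delta_mx 0 x + delta_mx 0 y.
Proof.
move=> xy; apply/rowP => u; rewrite pair_weightE !mxE eqxx /=.
by have [->|_] := eqVneq u x; rewrite ?(negPf xy) ?addr0 ?add0r.
Qed.

Lemma delta_row_inj n : injective (fun x : 'I_n => delta_mx 0 x : 'rV[F]_n).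
Proof.
by move=> x y; rewrite -!pair_weight_diag => /pair_weight_inj[] [].
Qed.

(** * Recognizing vertices and edges among the rows *)

Section WeightMatrix.

Variables (G : graph) (N : nat) (W : 'M[F]_(N, order G)).
Hypothesis GW : weight_matrix_of W.
Implicit Types x y : 'I_(order G).

Lemma card_row_weight (t : 'rV_(order G)) : t != 0 ->
  #|[pred i | row i W == t]| = #|[pred p | graph_weight p == t]|.
Proof.
have [k /seq.permP/(_ (pred1 t))] := GW.
rewrite count_cat count_nseq !count_map => cnt t0.
move: cnt; rewrite /= eq_sym (negPf t0) mul0n addn0.
by rewrite -!size_filter !cardE => cnt; apply: cnt.
Qed.

Lemma row_weightP (t : 'rV_(order G)) : t != 0 ->
  (exists i, row i W = t) <-> (exists p, graph_weight p = t).
Proof.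
move=> t0; split=> [[i Wi]|[p pt]].
  have : (0 < #|[pred p | graph_weight p == t]|)%N.
    by rewrite -card_row_weight //; apply/card_gt0P; exists i; rewrite inE Wi.
  by case/card_gt0P => p /eqP; exists p.
have : (0 < #|[pred i | row i W == t]|)%N.
  by rewrite card_row_weight //; apply/card_gt0P; exists p; rewrite inE pt.
by case/card_gt0P => i /eqP; exists i.
Qed.

Lemma row_vertex x : exists i, row i W = delta_mx 0 x.
Proof.
rewrite -pair_weight_diag; apply/row_weightP; first exact: pair_weight_neq0.
by exists (x, x); rewrite /graph_weight /= eqxx orbT.
Qed.

(** Only the cell (x, x) has weight e_x, every other nonzero weight having a different support. *)
Lemma row_vertex_inj x i j : row i W = delta_mx 0 x -> row j W = delta_mx 0 x -> i = j.
Proof.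
rewrite -pair_weight_diag => Wi Wj.
suff : (#|[pred i | row i W == pair_weight x x]| <= 1)%N.
  by move/card_le1P/(_ i); rewrite inE Wi eqxx => /(_ isT)/(_ j); rewrite !inE Wj eqxx => /esym/eqP.
rewrite card_row_weight ?pair_weight_neq0 //; apply/card_le1P => p.
suff px q : graph_weight q == pair_weight x x -> q = (x, x).
  move=> /px -> q; rewrite !inE; apply/idP/eqP => [/px|->] //.
  by rewrite /graph_weight /= eqxx orbT.
case: q => [y z]; rewrite /graph_weight /=; case: ifP => _.
  by case/eqP/pair_weight_inj => [] [-> ->].
by rewrite eq_sym (negPf (pair_weight_neq0 _ _)).
Qed.

(** A nonzero row is the weight of a diagonal cell or of an edge, and an edge weight recurs at the
    transposed cell. *)
Lemma row_simple i : row i W != 0 -> (forall j, row j W = row i W -> j = i) ->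
  exists x, row i W = delta_mx 0 x.
Proof.
move=> Wi0 Wi1.
have /(row_weightP Wi0)[[x y]] : exists j, row j W = row i W by exists i.
rewrite /graph_weight /=; case: ifP => [xy Wi|_ Wi]; last by rewrite -Wi eqxx in Wi0.
have [exy|nxy] := eqVneq x y; first by exists x; rewrite -Wi -exy pair_weight_diag.
have : (1 < #|[pred p | graph_weight p == row i W]|)%N.
  apply/card_gt1P; exists (x, y), (y, x); rewrite !inE /graph_weight /= xy.
  rewrite adj_sym [y == x]eq_sym xy (pair_weightC y x) Wi eqxx; split=> //.
  by rewrite xpair_eqE negb_and nxy.
rewrite -card_row_weight // => /card_gt1P[j [j' []]].
by rewrite !inE => /eqP/Wi1 -> /eqP/Wi1 ->; rewrite eqxx.
Qed.

Lemma row_edge x y : x != y -> (exists i, row i W = pair_weight x y) <-> adj x y.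
Proof.
move=> xy; rewrite row_weightP ?pair_weight_neq0 //; split=> [[[x' y']]|axy].
  rewrite /graph_weight /=; case: ifP => [a /pair_weight_inj|_ /esym/eqP].
    have {}a : x' != y' -> adj x' y' by move=> n; rewrite (negPf n) orbF in a.
    case=> [[ex ey]|[ex ey]]; subst; first exact: a.
    by rewrite adj_sym a // eq_sym.
  by rewrite (negPf (pair_weight_neq0 _ _)).
by exists (x, y); rewrite /graph_weight /= axy.
Qed.

End WeightMatrix.

(** [D] carries row i of [W] to row s i of [Z], and [C] carries it back. Being nonzero and of
    multiplicity one survives this, so vertices go to vertices; edges follow by linearity. One
    direction of adjacency is enough, since the lemma is applied again with the graphs exchanged. *)
Lemma conjugate_weights_vertex_map (G H : graph) N (W : 'M[F]_(N, order G))
    (Z : 'M[F]_(N, order H)) (s : 'S_N) C D :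
    weight_matrix_of W -> weight_matrix_of Z ->
    W = row_perm s Z *m C -> row_perm s Z = W *m D ->
  exists f : 'I_(order G) -> 'I_(order H),
    (forall x, delta_mx 0 x *m D = delta_mx 0 (f x) :> 'rV_(order H)) /\
    (forall x, delta_mx 0 (f x) *m C = delta_mx 0 x :> 'rV_(order G)) /\
    (forall x y, adj x y -> adj (f x) (f y)).
Proof.
move=> GW HZ WZ ZW.
have rowW i : row i W = row (s i) Z *m C.
  by rewrite [in LHS]WZ row_mul row_permEsub; congr (_ *m _); apply/rowP => j; rewrite !mxE.
have rowZ i : row (s i) Z = row i W *m D.
  by rewrite -row_mul -ZW; apply/rowP => j; rewrite !mxE.
have fP x : exists y : 'I_(order H), delta_mx 0 x *m D = delta_mx 0 y :> 'rV_(order H).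
  have [i Wi] := row_vertex GW x.
  rewrite -Wi -rowZ; apply: (row_simple HZ).
    apply: contra_eqN Wi => /eqP Z0; rewrite rowW Z0 mul0mx -pair_weight_diag eq_sym.
    exact: pair_weight_neq0.
  (* A second copy of the row in [Z] would come back under [C] as a second row e_x of [W]. *)
  move=> j; rewrite -(permKV s j) => Zj; congr (s _).
  by apply: (row_vertex_inj GW (x := x)) => //; rewrite rowW Zj -rowW.
have [f fD] := fin_all_exists fP; exists f; split=> //.
have fC x : delta_mx 0 (f x) *m C = delta_mx 0 x :> 'rV_(order G).
  have [i Wi] := row_vertex GW x.
  by rewrite -fD -Wi -rowZ -rowW.
split=> // x y axy.
have xy : x != y by apply: contraTneq axy => ->; rewrite adj_irrefl.
(* [C] undoes [f], so the images are distinct and their pair weight is the sum that [D] produces. *)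
have fxy : f x != f y.
  apply: contraNneq xy => efxy; apply/eqP/delta_row_inj.
  by rewrite -fC efxy fC.
have [i Wi] := (row_edge GW xy).2 axy.
apply/(row_edge HZ fxy); exists (s i).
by rewrite rowZ Wi pair_weight_sum // mulmxDl !fD pair_weight_sum.
Qed.

Lemma conjugate_weights_graph_iso (G H : graph) N (W : 'M[F]_(N, order G))
    (Z : 'M[F]_(N, order H)) :
    weight_matrix_of W -> weight_matrix_of Z ->
  (exists A, conjugates A <<diag_basis W>>%VS <<diag_basis Z>>%VS) <-> graph_iso G H.
Proof.
move=> GW HZ; rewrite conjugates_diag_basisP; split=> [[s [C [D [WZ ZW]]]]|[f fB fadj]].
  have [f [fD [fC fadj]]] := conjugate_weights_vertex_map GW HZ WZ ZW.
  (* Exchanging the graphs inverts [s] and swaps [C] and [D]; the two vertex maps are mutually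
     inverse. *)
  have [||g [gD [gC gadj]]] := @conjugate_weights_vertex_map H G N Z W (s^-1)%g D C HZ GW.
  - by rewrite -(row_perm1 Z) -(mulVg s) row_permM ZW !row_permE mulmxA.
  - by rewrite WZ !row_permE !mulmxA -perm_mxM mulVg perm_mx1 mul1mx.
  have fK : cancel f g by move=> x; apply: delta_row_inj; rewrite -gD fC.
  have gK : cancel g f by move=> x; apply: delta_row_inj; rewrite -fD gC.
  exists f; first by exists g.
  move=> x y; apply/idP/idP; last exact: fadj.
  by move/gadj; rewrite !fK.
have [k permW] := GW; have [l permZ] := HZ.
have [g fK gK] := fB.
(* On row vectors, [C] pulls coordinates back along [f], and [D] along its inverse [g]. *)
pose C : 'M[F]_(order H, order G) := \matrix_(v, u) (v == f u)%:R.
pose D : 'M[F]_(order G, order H) := \matrix_(u, v) (v == f u)%:R.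
have CE (t : 'rV[F]_(order H)) u : (t *m C) 0 u = t 0 (f u).
  rewrite mxE (bigD1 (f u)) //= mxE eqxx mulr1 big1 ?addr0 // => v.
  by rewrite mxE => /negPf ->; rewrite mulr0.
have DE (t : 'rV[F]_(order G)) v : (t *m D) 0 v = t 0 (g v).
  rewrite mxE (bigD1 (g v)) //= mxE gK eqxx mulr1 big1 ?addr0 // => u.
  by rewrite mxE -(can_eq fK) gK eq_sym => /negPf ->; rewrite mulr0.
have DK (t : 'rV[F]_(order G)) : t *m D *m C = t.
  by apply/rowP => u; rewrite CE DE fK.
have permWD : perm_eq [seq row i W *m D | i <- enum 'I_N] [seq row i Z | i <- enum 'I_N].
  (* Both matrices have N rows and, the orders being equal, equally many cell weights, hence equally
     many padding rows. *)
  have ekl : k = l.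
    have cardGH : order G = order H by rewrite -[LHS]card_ord -[RHS]card_ord (bij_eq_card fB).
    move/perm_size: permW; move/perm_size: permZ.
    rewrite !size_cat !size_map !size_nseq -!enumT -!cardE !card_prod !card_ord cardGH => ->.
    by move/addnI.
  rewrite perm_sym in permZ; apply: perm_trans permZ.
  rewrite [X in perm_eq X _](_ : _ = map (mulmx^~ D) [seq row i W | i <- enum 'I_N]).
    apply: perm_trans (perm_map _ permW) _.
    rewrite map_cat map_nseq mul0mx ekl perm_cat2r.
    have weightD p : graph_weight p *m D = graph_weight (f p.1, f p.2).
      rewrite /graph_weight /= fadj (inj_eq (can_inj fK)); case: ifP => _; last exact: mul0mx.
      by apply/rowP => v; rewrite DE !pair_weightE -!(can2_eq gK fK).
    rewrite -map_comp (eq_map weightD).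
    rewrite (map_comp (@graph_weight H) (fun p => (f p.1, f p.2))); apply: perm_map.
    apply: uniq_perm.
    - rewrite map_inj_uniq ?enum_uniq // => -[x y] [x' y'] /= [].
      by move=> /(can_inj fK) -> /(can_inj fK) ->.
    - exact: enum_uniq.
    - move=> [x y]; rewrite mem_enum; apply/mapP; exists (g x, g y); first by rewrite mem_enum.
      by rewrite /= !gK.
  by rewrite -[RHS]map_comp.
have /tuple_permP[s sP] : perm_eq [seq row i W *m D | i <- enum 'I_N] [tuple row i Z | i < N].
  exact: permWD.
have sZ i : row i W *m D = row (s i) Z.
  have /(congr1 (fun t => nth 0 t i)) := sP.
  rewrite (nth_map i) ?size_enum_ord // nth_ord_enum => ->.
  by rewrite -tnth_nth tnth_mktuple tnth_mktuple.
have ZW : row_perm s Z = W *m D.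
  by apply/row_matrixP => i; rewrite row_mul sZ; apply/rowP => j; rewrite !mxE.
exists s, C, D; split=> //.
by rewrite ZW; apply/row_matrixP => i; rewrite !row_mul DK.
Qed.

End GraphWeights.

(** * Machines that sweep over their input *)

(** Finiteness of [symbol] allows a bounded word to be stored in the state of a machine. *)
Definition symbol_code (s : symbol) : bool + 'I_4 :=
  match s with
  | Bit b => inl b
  | Comma => inr (inord 0)
  | Semi => inr (inord 1)
  | Bar => inr (inord 2)
  | Slash => inr (inord 3)
  end.

Definition symbol_decode (c : bool + 'I_4) : symbol :=
  match c with
  | inl b => Bit b
  | inr i => nth Slash [:: Comma; Semi; Bar] i
  end.

Lemma symbol_codeK : cancel symbol_code symbol_decode.
Proof. by case=> //=; rewrite inordK. Qed.

HB.instance Definition _ := Finite.copy symbol (can_type symbol_codeK).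

(* A sweeper repeatedly reads its tape from left to right, rewriting each cell
   and emitting words; at the right end it either stops or starts over. *)
Record sweeper := Sweeper {
  sw_state : finType;
  sw_cell : finType;
  sw_load : symbol -> sw_cell;
  sw_next : sw_state -> sw_cell -> sw_state;
  sw_write : sw_state -> sw_cell -> sw_cell;
  sw_emit : sw_state -> sw_cell -> word;
  sw_turn : sw_state -> option sw_state;
  sw_close : sw_state -> word
}.

Section SweeperRun.

Variable S : sweeper.
Implicit Types (q : sw_state S) (s : seq (sw_cell S)).

Definition sweep_state q s := foldl (@sw_next S) q s.

Fixpoint sweep_write q s : seq (sw_cell S) :=
  if s is a :: s' then sw_write q a :: sweep_write (sw_next q a) s' else [::].

Fixpoint sweep_emit q s : word :=
  if s is a :: s' then sw_emit q a ++ sweep_emit (sw_next q a) s' else [::].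

(** The number counts the sweeps; it yields the time bound of the simulating machine. *)
Inductive sweeps : sw_state S -> seq (sw_cell S) -> word -> nat -> Prop :=
| SweepsStop q s :
    sw_turn (sweep_state q s) = None ->
    sweeps q s (sweep_emit q s ++ sw_close (sweep_state q s)) 1
| SweepsNext q s q' v k :
    sw_turn (sweep_state q s) = Some q' ->
    sweeps q' (sweep_write q s) v k ->
    sweeps q s (sweep_emit q s ++ sw_close (sweep_state q s) ++ v) k.+1.

Lemma size_sweep_write q s : size (sweep_write q s) = size s.
Proof. by elim: s q => //= a s IHs q; rewrite IHs. Qed.

Lemma sweep_state_cat q s1 s2 :
  sweep_state q (s1 ++ s2) = sweep_state (sweep_state q s1) s2.
Proof. exact: foldl_cat. Qed.

Lemma sweep_write_cat q s1 s2 :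
  sweep_write q (s1 ++ s2) = sweep_write q s1 ++ sweep_write (sweep_state q s1) s2.
Proof. by elim: s1 q => //= a s1 IHs q; rewrite IHs. Qed.

Lemma sweep_emit_cat q s1 s2 :
  sweep_emit q (s1 ++ s2) = sweep_emit q s1 ++ sweep_emit (sweep_state q s1) s2.
Proof. by elim: s1 q => //= a s1 IHs q; rewrite IHs catA. Qed.

End SweeperRun.

(** * Simulation of a sweeper by a two-tape machine *)

Section SweeperMachine.

Variables (S : sweeper) (q0 : sw_state S) (K : nat).
Hypothesis emitK : forall q a, (size (@sw_emit S q a) <= K)%N.
Hypothesis closeK : forall q, (size (@sw_close S q) <= K)%N.

(* The machine emits one symbol per step: its state holds whether it is
   rewinding, the sweeper's state, and the symbols still to be emitted. *)
Definition sm_state : finType := (bool * option (sw_state S) * K.-bseq symbol)%type.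

(** [insub_bseq] falls back on the empty word if [w] is longer than [K]; [emitK] and [closeK]
    exclude this for the words emitted. *)
Definition pending (w : word) : K.-bseq symbol := insub_bseq K w.

(** The first sweep finds raw input symbols and loads them as it reads; later sweeps find cells
    already rewritten. *)
Definition cell_content (c : symbol + sw_cell S) : sw_cell S :=
  match c with inl a => sw_load S a | inr a => a end.

(** Pending symbols go out first, with the input head at rest. The blank to the right of the word
    triggers the turn, the blank at -1 ends the rewinding. A turn to [None] halts the machine once
    the closing word is out. *)
Definition sm_act (st : sm_state) (x : cell (sw_cell S)) :
    sm_state * (cell (sw_cell S) * move) * option symbol :=
  let: (back, q, p) := st in
  match bseqval p, q with
  | a :: p', _ => (back, q, pending p', (x, Stay), Some a)
  | [::], None => (st, (x, Stay), None)
  | [::], Some q' =>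
    match back, x with
    | true, Some _ => (st, (x, MoveLeft), None)
    | true, None => (false, q, pending [::], (x, MoveRight), None)
    | false, Some c =>
      (false, Some (sw_next q' (cell_content c)), pending (sw_emit q' (cell_content c)),
       (Some (inr (sw_write q' (cell_content c))), MoveRight), None)
    | false, None => (true, sw_turn q', pending (sw_close q'), (x, MoveLeft), None)
    end
  end.

Definition sm_trans (st : sm_state) (r : {ffun 'I_2 -> cell (sw_cell S)}) :
    sm_state * {ffun 'I_2 -> cell (sw_cell S) * move} :=
  let: (st', act, e) := sm_act st (r ord0) in
  (st', [ffun i => if i == ord0 then act else
           if e is Some a then (Some (inl a), MoveRight) else (r i, Stay)]).

Definition sm_halted : pred sm_state :=
  fun st => (st.1.2 == None) && (bseqval st.2 == [::]).

Definition sweeper_machine : machine :=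
  Machine (extra_tapes := 0) (false, Some q0, pending [::]) sm_halted sm_trans.

Notation M := sweeper_machine.

Definition cells_at (s : seq (symbol + sw_cell S)) (z : int) : cell (sw_cell S) :=
  match z with
  | Posz i => nth None [seq Some c | c <- s] i
  | Negz _ => None
  end.

Definition snapshot (c : config M) st (h : int) s (out : word) : Prop :=
  [/\ cstate c = st, chead c ord0 = h, chead c ord_max = size out,
      ctape c ord0 =1 cells_at s & ctape c ord_max =1 tape_of (sw_cell S) out].

Arguments sm_act : simpl never.
Arguments cells_at : simpl never.

Lemma pendingK w : (size w <= K)%N -> bseqval (pending w) = w.
Proof. by move=> wK; rewrite /pending /insub_bseq insubdK. Qed.

Lemma snapshot_step c st h s out st' x m e s' :
    snapshot c st h s out -> ~~ sm_halted st ->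
    sm_act st (cells_at s h) = (st', (x, m), e) ->
    (forall z, cells_at s' z = if z == h then x else cells_at s z) ->
  snapshot (step c) st' (h + shift m) s' (out ++ seq_of_opt e).
Proof.
case=> cst ch0 ch1 ct0 ct1 nh act s'P; rewrite /step cst.
rewrite (_ : halted (st : state M) = false); last exact: negbTE.
rewrite /= /sm_trans ffunE ch0 ct0 act; split=> //=.
- by rewrite ffunE eqxx ch0.
- rewrite ffunE /= ch1; case: e {act} => [a|] /=; last by rewrite cats0 addr0.
  by rewrite size_cat addn1 -addn1 PoszD.
- by move=> z; rewrite ffunE eqxx ch0 ct0 s'P.
- move=> z; rewrite ffunE /= ct1 ch1; case: e {act} => [a|] /=.
    case: z => [i|i] //=; rewrite map_cat nth_cat size_map /= eqz_nat.
    case: (ltngtP i (size out)) => [//|gt|->]; last by rewrite subnn.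
    by rewrite !nth_default ?size_map ?subn_gt0 // ltnW.
  rewrite cats0 !ffunE ct1 ch1; case: eqP => // ->.
  by [].
Qed.

Lemma snapshot_emit c back q p h s out :
    snapshot c (back, q, p) h s out ->
  snapshot (iter (size p) (@step M) c) (back, q, pending [::]) h s (out ++ p).
Proof.
move: {2}(size p) (erefl (size p)) => k; elim: k c p out => [|k IHk] c p out.
  move=> /size0nil p0; rewrite p0 cats0 => cP.
  suff -> : pending [::] = p by [].
  by apply: val_inj; rewrite /= p0 pendingK.
case: p => -[|a p'] pK //= [sz] cP; rewrite -iterS iterSr.
have p'K : (size p' <= K)%N := ltnW pK.
have := IHk (step c) (pending p') (out ++ [:: a]).
rewrite pendingK // sz -catA; apply=> //.
have := snapshot_step (s' := s) cP; rewrite /sm_halted /= andbF => /(_ _ _ _ _ isT erefl).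
by rewrite addr0; apply=> z; case: eqP => [->|].
Qed.

Lemma cells_at_size l r : cells_at (l ++ r) (size l) = ohead r.
Proof. by rewrite /cells_at map_cat nth_cat size_map ltnn subnn; case: r. Qed.

Lemma cells_at_update l c c' r z :
  cells_at (l ++ c' :: r) z = if z == size l then Some c' else cells_at (l ++ c :: r) z.
Proof.
rewrite /cells_at; case: z => [i|i] //=; rewrite eqz_nat !map_cat !nth_cat !size_map /=.
case: (ltngtP i (size l)) => [//|gt|->]; last by rewrite subnn.
by case: (i - size l)%N (subn_gt0 (size l) i) => [|j] //=; rewrite gt.
Qed.

(** Each cell costs one step to read and at most [K] steps to emit. *)
Lemma snapshot_sweep c q l r out :
    snapshot c (false, Some q, pending [::]) (size l) (l ++ r) out ->
  exists2 t, (t <= K.+1 * size r)%N &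
  snapshot (iter t (@step M) c)
    (false, Some (sweep_state q (map cell_content r)), pending [::])
    (size l + size r)%N (l ++ map inr (sweep_write q (map cell_content r)))
    (out ++ sweep_emit q (map cell_content r)).
Proof.
elim: r c q l out => [|x r IHr] c q l out cP.
  by exists 0; rewrite // !cats0 addn0 in cP *.
set a := cell_content x.
have /= step1 := snapshot_step (st' := (false, Some (sw_next q a), pending (sw_emit q a)))
  (x := Some (inr (sw_write q a))) (m := MoveRight) (e := None)
  (s' := l ++ inr (sw_write q a) :: r) cP isT.
rewrite cells_at_size /sm_act /= pendingK //= in step1.
have {step1}/snapshot_emit := step1 erefl (cells_at_update l x _ r).
rewrite cats0 pendingK // -cat_rcons -[_ + 1]/(Posz (size l + 1)) addn1.
rewrite -(size_rcons l (inr (sw_write q a))) => /IHr[t tP].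
rewrite -iterSr -iterD size_rcons cat_rcons -catA => cP'.
exists (t + (size (sw_emit q a)).+1)%N; last first.
  by rewrite [X in Posz X]addnS -addSn.
rewrite mulnS /= addnC; apply: leq_add => //.
exact: emitK.
Qed.

(** The extra step turns round on the blank cell -1. *)
Lemma snapshot_rewind c q l r out :
    snapshot c (true, Some q, pending [::]) ((size l)%:Z - 1) (l ++ r) out ->
  snapshot (iter (size l).+1 (@step M) c) (false, Some q, pending [::]) 0 (l ++ r) out.
Proof.
elim/last_ind: l c r => [|l x IHl] c r cP.
  have /= := snapshot_step (s' := r) (st' := (false, Some q, pending [::]))
    (x := None) (m := MoveRight) (e := None) cP isT.
  rewrite (_ : cells_at _ _ = None) // /sm_act /= pendingK //= cats0; apply=> // z.
  by case: eqP => [->|].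
rewrite size_rcons iterSr cat_rcons; apply: IHl.
have /= := snapshot_step (s' := l ++ x :: r) (st' := (true, Some q, pending [::]))
  (x := Some x) (m := MoveLeft) (e := None) cP isT.
rewrite size_rcons -addn1 PoszD addrK cat_rcons cells_at_size /sm_act /= pendingK // cats0.
apply=> // z; exact: cells_at_update.
Qed.

Lemma snapshot_turn c q s out :
    snapshot c (false, Some q, pending [::]) (size s) s out ->
  snapshot (iter (size (sw_close q)).+1 (@step M) c)
    (true, sw_turn q, pending [::]) ((size s)%:Z - 1) s (out ++ sw_close q).
Proof.
move=> cP; rewrite iterSr.
have at_end : cells_at s (size s) = None by rewrite -{1}(cats0 s) cells_at_size.
have /= := snapshot_step (s' := s) (st' := (true, sw_turn q, pending (sw_close q)))
  (x := None) (m := MoveLeft) (e := None) cP isT.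
rewrite at_end /sm_act /= pendingK // cats0 => /(_ erefl) step1.
have /step1/snapshot_emit : forall z, cells_at s z = if z == size s then None else cells_at s z.
  by move=> z; case: eqP => // ->.
by rewrite pendingK.
Qed.

(** With n cells, a sweep takes at most (K+1)n steps for reading and emitting, K+1 for closing and
    n+1 for rewinding: (K+2)(n+1) altogether. *)
Lemma snapshot_sweeps c q s w k out :
    sweeps q (map cell_content s) w k ->
    snapshot c (false, Some q, pending [::]) 0 s out ->
  exists2 t, (t <= k * (K.+2 * (size s).+1))%N &
  let c' := iter t (@step M) c in
  sm_halted (cstate c') /\ ctape c' ord_max =1 tape_of (sw_cell S) (out ++ w).
Proof.
move: {2}(map _ s) (erefl (map cell_content s)) => cs csE; rewrite csE => wP.
elim: wP c s out csE => {q w k cs} [q cs|q cs q' w k] turn => [|wP IHw] c s out csE cP.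
  have [t tP] := snapshot_sweep (l := [::]) cP.
  rewrite add0n /= csE; set s' := map inr _ => cP'.
  have ss' : size s' = size s by rewrite size_map size_sweep_write -csE size_map.
  rewrite -ss' in cP'; have := snapshot_turn cP'; rewrite turn -iterD => -[cst _ _ _ ct].
  exists ((size (sw_close (sweep_state q cs))).+1 + t)%N.
    by have := closeK (sweep_state q cs); nia.
  by rewrite /= cst /sm_halted /= pendingK // eqxx; split=> //; rewrite catA.
have [t tP] := snapshot_sweep (l := [::]) cP.
rewrite add0n /= csE; set s' := map inr _ => cP'.
have ss' : size s' = size s by rewrite size_map size_sweep_write -csE size_map.
rewrite -ss' in cP'; have := snapshot_turn cP'; rewrite turn -iterD.
rewrite -[X in snapshot _ _ _ X](cats0 s') => /snapshot_rewind.
rewrite cats0 -iterD => /IHw[|t' t'P].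
  by rewrite -map_comp map_id_in.
rewrite -iterD -!catA => end_c.
exists (t' + ((size s').+1 + ((size (sw_close (sweep_state q cs))).+1 + t)))%N => //.
by have := closeK (sweep_state q cs); rewrite ss' in t'P *; nia.
Qed.

Lemma sweeper_machine_outputs w v k :
  sweeps q0 (map (@sw_load S) w) v k ->
  outputs_within M w v (k * (K.+2 * (size w).+1)).
Proof.
move=> wP; have c0 : snapshot (init M w) (false, Some q0, pending [::]) 0 (map inl w) [::].
  split=> //=; last by case=> [[|i]|i].
  by rewrite /cells_at; case=> [i|i] //=; rewrite -map_comp.
have wP' : sweeps q0 (map cell_content (map inl w)) v k by rewrite -map_comp.
have [t tP [halt_t out_t]] := snapshot_sweeps wP' c0.
by rewrite size_map in tP; exists t.
Qed.

End SweeperMachine.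

(** * Writing the bases *)

(* A cell carries its symbol and three marks: its row is the current vertex,
   its column is the current vertex, it is the current position. *)
Definition marked_cell : finType := (symbol * (bool * bool * bool))%type.

(* Count writes the size of the instance. Place moves the row and column marks
   of one of the two graphs on to the next vertex, and Print writes one row of
   the diagonal matrix of the marked vertex and moves the position mark. The
   flags [row] and [col] (in Place) and [here] (in Print) are the marks that the
   next cell is to receive; [col0] is the mark of the first cell in a row. *)
Inductive phase :=
| Count
| Place (second active col0 row col over : bool)
| Print (second last here : bool).

Definition phase_code (q : phase) :
    unit + (bool * bool * bool * bool * bool * bool) + (bool * bool * bool) :=
  match q with
  | Count => inl (inl tt)
  | Place a b c d e f => inl (inr (a, b, c, d, e, f))
  | Print a b c => inr (a, b, c)
  end.

Definition phase_decode
    (c : unit + (bool * bool * bool * bool * bool * bool) + (bool * bool * bool)) : phase :=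
  match c with
  | inl (inl _) => Count
  | inl (inr (a, b, c, d, e, f)) => Place a b c d e f
  | inr (a, b, c) => Print a b c
  end.

Lemma phase_codeK : cancel phase_code phase_decode.
Proof. by case. Qed.

HB.instance Definition _ := Finite.copy phase (can_type phase_codeK).

Definition unmarked (a : symbol) : marked_cell := (a, (false, false, false)).

(* The cell (x, y) contributes to the vertex u when {x, y} contains u and
   either x = y or xy is an edge. *)
Definition cell_entry (c : marked_cell) : bool :=
  let: (a, (r, k, _)) := c in
  if a is Bit b then (r && k) || (b && (r || k)) else false.

Section ReductionSweeper.

Variables (s0 s1 : seq bool).

Definition entry_word (b : bool) : word := map Bit (if b then s1 else s0).

(** In the active graph the old marks of the cell and of the row just read become the flags for the
    next ones, which moves the marks by one. At the slash closing that graph, a set [row] is a mark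
    that has fallen off the end, so [over] tells that no vertex is left. *)
Definition phase_next (q : phase) (c : marked_cell) : phase :=
  let: (a, (r, k, i)) := c in
  match q with
  | Count => Count
  | Place g act col0 row col over =>
    match a with
    | Bit _ => if act then Place g act col0 row k over else q
    | Semi => if act then Place g act col0 r col0 over else q
    | Slash => Place g (~~ act) col0 row col (if act then row else over)
    | _ => q
    end
  | Print g _ here => Print g here i
  end.

Definition phase_write (q : phase) (c : marked_cell) : marked_cell :=
  let: (a, (r, k, i)) := c in
  match q with
  | Count => c
  | Place _ act _ row col _ =>
    match a with
    | Bit _ => (a, (act && row, act && col, false))
    | Semi => (a, (act && row, false, false))
    | _ => unmarked a
    end
  | Print _ _ here => (a, (r, k, here))
  end.

Definition phase_emit (q : phase) (c : marked_cell) : word :=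
  match q with
  | Count => [:: Bit true]
  | Place _ act _ row _ _ => if c.1 is Slash then nseq (act && row) Slash else [::]
  | Print _ _ here => rcons (entry_word (here && cell_entry c)) Comma
  end.

(** At the first placement there are no marks to move, so the flags supply them for row and column
    0. *)
Definition place_start (second first : bool) : phase :=
  Place second (~~ second) first first first false.

Definition phase_turn (q : phase) : option phase :=
  match q with
  | Count => Some (place_start false true)
  | Place g _ _ _ _ over =>
    if over then if g then None else Some (place_start true true)
    else Some (Print g false true)
  | Print g last _ => Some (if last then place_start g false else Print g false false)
  end.

Definition phase_close (q : phase) : word :=
  match q with
  | Count => [:: Slash]
  | Place _ _ _ _ _ _ => [::]
  | Print _ last _ => Semi :: nseq last Bar
  end.

Definition reduction_sweeper : sweeper :=
  @Sweeper phase marked_cell unmarked phase_next phase_write phase_emit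
    phase_turn phase_close.

Notation S := reduction_sweeper.
Implicit Types (c : seq marked_cell) (q : sw_state S).

(** [k] is counted from one, so that k = 0 leaves every cell unmarked. A printing sweep that finds
    the mark [k] writes row [k], counted from zero, and leaves the mark [k.+1]. *)
Fixpoint with_position (p k : nat) c : seq marked_cell :=
  if c is (a, (r, h, _)) :: c' then (a, (r, h, p.+1 == k)) :: with_position p.+1 k c'
  else [::].

Lemma with_position0 p c : all (fun x => ~~ x.2.2) c -> with_position p 0 c = c.
Proof.
by elim: c p => //= -[a [[r h] i]] c IHc p /andP[/negPf /= -> c0]; rewrite IHc.
Qed.

(** Placing does not read position marks and erases them, so those left over from printing are
    harmless. *)
Lemma place_with_position g act col0 row col over p k c :
  let q := Place g act col0 row col over : sw_state S in
  [/\ sweep_state q (with_position p k c) = sweep_state q c,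
      sweep_write q (with_position p k c) = sweep_write q c
    & sweep_emit q (with_position p k c) = sweep_emit q c].
Proof.
elim: c act row col over p => [|[a [[r h] i]] c IHc] act row col over p //=.
case: a => [b||||] /=; try (by have [-> -> ->] := IHc act row col over p.+1).
- by case: act; [have [-> -> ->] := IHc true row h over p.+1
               | have [-> -> ->] := IHc false row col over p.+1].
- by case: act; [have [-> -> ->] := IHc true r col0 over p.+1
               | have [-> -> ->] := IHc false row col over p.+1].
- by have [-> -> ->] := IHc (~~ act) row col (if act then row else over) p.+1.
Qed.

(** [p] is the column of the first entry of [d], which permits induction along a row. *)
Definition diag_row_word (k p : nat) (d : seq bool) : word :=
  terminate Comma [seq entry_word ((jb.1 == k) && jb.2) | jb <- zip (iota p (size d)) d].

Definition diag_word (d : seq bool) : word :=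
  terminate Semi [seq diag_row_word k 0 d | k <- iota 0 (size d)].

(** Invariant before cell [p]: [here] says that this cell is the diagonal position [k], and [last]
    that the preceding one was. *)
Lemma print_sweep g p k c :
  let q := Print g (p == k.+1) (p == k) : sw_state S in
  [/\ sweep_state q (with_position p k c) = Print g (p + size c == k.+1)%N (p + size c == k)%N,
      sweep_write q (with_position p k c) = with_position p k.+1 c
    & sweep_emit q (with_position p k c) = diag_row_word k p (map cell_entry c)].
Proof.
elim: c p => [|[a [[r h] i]] c IHc] p /=; first by rewrite !addn0.
have := IHc p.+1; rewrite eqSS => -[-> -> ->]; rewrite !addSnnS; split=> //.
Qed.

(** The sweep for the last row ends with [last] set, so it adds the bar and hands over to
    placing. *)
Lemma print_sweeps g k r c v m :
    (k + r.+1)%N = size c ->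
    sweeps (place_start g false : sw_state S) (with_position 0 (size c) c) v m ->
  sweeps (Print g false (k == 0)%N : sw_state S) (with_position 0 k c)
    (terminate Semi [seq diag_row_word k' 0 (map cell_entry c) | k' <- iota k r.+1] ++ Bar :: v)
    (r.+1 + m).
Proof.
elim: r k => [|r IHr] k kc next.
  have [st wr em] := print_sweep g 0 k c; rewrite addn1 in kc.
  rewrite add0n /= -kc eqxx (eq_sym 0%N k) in st wr em.
  have := @SweepsNext S (Print g false (k == 0)%N) (with_position 0 k c) (place_start g false) v m.
  rewrite st wr em kc => /(_ erefl next) /=.
  by rewrite /terminate /= cats0 -cats1 -!catA.
have [st wr em] := print_sweep g 0 k c.
have lt_k : (k.+1 < size c)%N by rewrite -kc; lia.
rewrite add0n /= (eq_sym 0%N k) (gtn_eqF lt_k) (gtn_eqF (ltnW lt_k)) in st wr em.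
have /IHr/(_ next) next' : (k.+1 + r.+1)%N = size c by rewrite addSnnS.
have := @SweepsNext S (Print g false (k == 0)%N) (with_position 0 k c) (Print g false false).
rewrite st wr em => /(_ _ _ erefl next') /=.
by rewrite /terminate /= -!cats1 -!catA.
Qed.

(** * Encodings of the graphs with a marked vertex *)

Definition row_cells (G : graph) (v : nat) (r : bool) (x : 'I_(order G))
    (ys : seq 'I_(order G)) : seq marked_cell :=
  rcons [seq (Bit (adj x y), (r, y.+1 == v, false)) | y : 'I_(order G) <- ys]
        (Semi, (r, false, false)).

Definition rows_cells (G : graph) (v : nat) (xs : seq 'I_(order G)) : seq marked_cell :=
  flatten [seq row_cells v (x.+1 == v) x (enum 'I_(order G)) | x : 'I_(order G) <- xs].

(* The encoding of G with the marks for its v-th vertex, where v = 0 means that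
   no vertex is marked. *)
Definition graph_cells (G : graph) (v : nat) := rows_cells v (enum 'I_(order G)).

Definition pair_cells (G H : graph) (v v' : nat) : seq marked_cell :=
  graph_cells G v ++ unmarked Slash :: graph_cells H v' ++ [:: unmarked Slash].

Lemma map_unmarked_pair (G H : graph) :
  map unmarked (terminate Slash [:: graph_word G; graph_word H]) = pair_cells G H 0 0.
Proof.
have graph_unmarked K : map unmarked (graph_word K) = graph_cells K 0.
  have row_unmarked (x : 'I_(order K)) ys :
      map unmarked (rcons [seq Bit (adj x y) | y <- ys] Semi) = row_cells 0 false x ys.
    by elim: ys => //= y ys ->.
  suff rows_unmarked xs : map unmarked (terminate Semi
      [seq [seq Bit (adj x y) | y <- enum 'I_(order K)] | x : 'I_(order K) <- xs])
      = rows_cells 0 xs by exact: rows_unmarked.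
  rewrite /terminate /rows_cells.
  by elim: xs => //= x xs; rewrite map_cat => ->; rewrite row_unmarked.
by rewrite /terminate /= cats0 -!cats1 !map_cat /= !graph_unmarked -catA.
Qed.

(** Marks moved past the last vertex are gone, so the second graph is treated on a clean tape. *)
Lemma graph_cells_overflow (G : graph) : graph_cells G (order G).+1 = graph_cells G 0.
Proof.
congr flatten; apply: eq_map => x; rewrite eqSS ltn_eqF //; congr rcons.
by apply: eq_map => y; rewrite eqSS ltn_eqF.
Qed.

Lemma pair_cells_position (G H : graph) v v' :
  all (fun x => ~~ x.2.2) (pair_cells G H v v').
Proof.
have graph_position K w : all (fun x : marked_cell => ~~ x.2.2) (graph_cells K w).
  apply/allP => c /flatten_mapP[x _]; rewrite mem_rcons inE => /orP[/eqP -> //|].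
  by case/mapP => y _ ->.
by rewrite all_cat graph_position /= all_cat graph_position.
Qed.

(** Before column [y0], the flag [y0 == v] is the old mark of the preceding column or, for y0 = 0,
    the initial flag. *)
Lemma place_row (G : graph) g v r row y0 over (x : 'I_(order G)) ys :
    map val ys = iota y0 (size ys) ->
  let q := Place g true (0 == v)%N row (y0 == v)%N over : sw_state S in
  [/\ sweep_state q (row_cells v r x ys) = Place g true (0 == v)%N r (0 == v)%N over,
      sweep_write q (row_cells v r x ys) = row_cells v.+1 row x ys
    & sweep_emit q (row_cells v r x ys) = [::]].
Proof.
elim: ys y0 => [|y ys IHys] y0 //= [<- ysE].
by have [-> -> ->] := IHys _ ysE.
Qed.

Lemma place_rows (G : graph) g v x0 over (xs : seq 'I_(order G)) :
    map val xs = iota x0 (size xs) ->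
  let q := Place g true (0 == v)%N (x0 == v)%N (0 == v)%N over : sw_state S in
  [/\ sweep_state q (rows_cells v xs) =
        Place g true (0 == v)%N (x0 + size xs == v)%N (0 == v)%N over,
      sweep_write q (rows_cells v xs) = rows_cells v.+1 xs
    & sweep_emit q (rows_cells v xs) = [::]].
Proof.
elim: xs x0 => [|x xs IHxs] x0 /=; first by rewrite addn0.
case=> <- xsE; rewrite /rows_cells /= sweep_state_cat sweep_write_cat sweep_emit_cat.
have enumE : map val (enum 'I_(order G)) = iota 0 (size (enum 'I_(order G))).
  by rewrite val_enum_ord size_enum_ord.
have [-> -> ->] := place_row g v (x.+1 == v) (val x == v) over x enumE.
by have [-> -> ->] := IHxs _ xsE; rewrite addSnnS.
Qed.

Lemma place_inactive (G : graph) g col0 row col over :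
  let q := Place g false col0 row col over : sw_state S in
  [/\ sweep_state q (graph_cells G 0) = q,
      sweep_write q (graph_cells G 0) = graph_cells G 0
    & sweep_emit q (graph_cells G 0) = [::]].
Proof.
move=> q; have row_inactive (x : 'I_(order G)) ys :
    [/\ sweep_state q (row_cells 0 false x ys) = q,
        sweep_write q (row_cells 0 false x ys) = row_cells 0 false x ys
      & sweep_emit q (row_cells 0 false x ys) = [::]].
  by elim: ys => //= y ys [-> -> ->].
rewrite /graph_cells; elim: (enum _) => // x xs [st wr em].
rewrite /rows_cells /= sweep_state_cat sweep_write_cat sweep_emit_cat.
have [-> -> ->] := row_inactive x (enum 'I_(order G)).
by rewrite st wr em.
Qed.

Definition side_graph (G H : graph) (g : bool) := if g then H else G.

Definition side_cells (G H : graph) (g : bool) (v : nat) :=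
  if g then pair_cells G H 0 v else pair_cells G H v 0.

(** The turn depends only on [over] and on which graph is treated; the other flags are left
    existential. *)
Lemma place_sweep (G H : graph) g v :
  let q := place_start g (0 == v)%N : sw_state S in
  let n := order (side_graph G H g) in
  [/\ exists act col0 row col,
        sweep_state q (side_cells G H g v) = Place g act col0 row col (n == v),
      sweep_write q (side_cells G H g v) = side_cells G H g v.+1
    & sweep_emit q (side_cells G H g v) = nseq (n == v) Slash].
Proof.
have place_graph K := @place_rows K g v 0 false (enum 'I_(order K)).
case: g place_graph => place_graph /=.
  have [st1 wr1 em1] := place_inactive G true (0 == v)%N (0 == v)%N (0 == v)%N false.
  have [|st2 wr2 em2] := place_graph H; first by rewrite val_enum_ord size_enum_ord.
  rewrite size_enum_ord add0n in st2.
  rewrite /pair_cells /place_start !sweep_state_cat !sweep_write_cat !sweep_emit_cat /=.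
  rewrite st1 wr1 em1 /= !sweep_state_cat !sweep_write_cat !sweep_emit_cat /=.
  rewrite st2 wr2 em2 /= cats0; split=> //.
  by do 4!eexists.
have [st1 wr1 em1] :=
  place_inactive H false (0 == v)%N (order G == v)%N (0 == v)%N (order G == v)%N.
have [|st2 wr2 em2] := place_graph G; first by rewrite val_enum_ord size_enum_ord.
rewrite size_enum_ord add0n in st2.
rewrite /pair_cells /place_start !sweep_state_cat !sweep_write_cat !sweep_emit_cat /=.
rewrite st2 wr2 em2 /= !sweep_state_cat !sweep_write_cat !sweep_emit_cat /=.
rewrite st1 wr1 em1 /= !cats0; split=> //.
by do 4!eexists.
Qed.

Lemma size_side_cells (G H : graph) g v :
  size (side_cells G H g v) = size (pair_cells G H 0 0).
Proof.
have size_rows K w xs : size (@rows_cells K w xs) = size (@rows_cells K 0 xs).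
  by elim: xs => //= x xs IHxs; rewrite !size_cat IHxs !size_rcons !size_map.
have size_graph K w : size (graph_cells K w) = size (graph_cells K 0) := size_rows K w _.
by rewrite /side_cells; case: g; rewrite !size_cat /= !size_cat !size_graph.
Qed.

Definition vertex_entries (G H : graph) (g : bool) (u : nat) : seq bool :=
  map cell_entry (side_cells G H g u.+1).

(** Here [v] vertices are done and [j] remain. Each takes one placing sweep and one printing sweep
    per cell; a last placing sweep finds no vertex left and writes the slash. [tail] is what
    follows: nothing after the second graph, the run for the second graph after the first. *)
Lemma side_sweeps (G H : graph) g v j p tail m :
    (v + j)%N = order (side_graph G H g) ->
    (if g then tail = [::] /\ m = 0%N
     else sweeps (place_start true true : sw_state S) (pair_cells G H 0 0) tail m) ->
  sweeps (place_start g (0 == v)%N : sw_state S) (with_position 0 p (side_cells G H g v))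
    (terminate Bar [seq diag_word (vertex_entries G H g u) | u <- iota v j] ++ Slash :: tail)
    (j * (size (pair_cells G H 0 0)).+1 + m.+1).
Proof.
move=> vj tailP; elim: j v p vj => [|j IHj] v p vj.
  have [pst pwr pem] := place_with_position g (~~ g) (0 == v)%N (0 == v)%N (0 == v)%N false 0 p
    (side_cells G H g v).
  have [[act [col0 [row [col st]]]] wr em] := place_sweep G H g v.
  rewrite -vj addn0 eqxx in wr em st.
  rewrite /place_start in wr em st; rewrite -pst in st; rewrite -pwr in wr; rewrite -pem in em.
  rewrite mul0n add0n /terminate /=.
  case: g vj tailP pst pwr pem st wr em => vj tailP pst pwr pem st wr em.
    have [-> ->] := tailP.
    have := @SweepsStop S (place_start true (0 == v)%N) (with_position 0 p (side_cells G H true v)).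
    by rewrite /place_start st em; apply.
  have := @SweepsNext S (place_start false (0 == v)%N) (with_position 0 p (side_cells G H false v))
    (place_start true true) tail m.
  rewrite /place_start st em wr; apply=> //.
  by rewrite /side_cells /pair_cells -[v]addn0 vj /= graph_cells_overflow.
have [pst pwr pem] := place_with_position g (~~ g) (0 == v)%N (0 == v)%N (0 == v)%N false 0 p
  (side_cells G H g v).
have [[act [col0 [row [col st]]]] wr em] := place_sweep G H g v.
have not_over : (order (side_graph G H g) == v) = false by rewrite -vj; lia.
rewrite not_over in em st.
rewrite /place_start in wr em st; rewrite -pst in st; rewrite -pwr in wr; rewrite -pem in em.
have := @SweepsNext S (place_start g (0 == v)%N) (with_position 0 p (side_cells G H g v))
  (Print g false true).
rewrite {1 2}/place_start st em wr => /(_ _ _ erefl) next.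
set N := size (pair_cells G H 0 0).
have N_gt0 : (0 < N)%N by rewrite /N size_cat /= addnS.
have := IHj v.+1 N; rewrite addSnnS => /(_ vj) printed.
have := @print_sweeps g 0 N.-1 (side_cells G H g v.+1) _ _ _.
rewrite add0n prednK // size_side_cells => /(_ _ _ erefl printed).
rewrite with_position0; last by rewrite /side_cells; case: (g); apply: pair_cells_position.
move/next; rewrite /= mulSn !addSn addnA.
rewrite /diag_word size_map size_side_cells -/N.
by rewrite /terminate /= -!catA cat_rcons -/(terminate _ _).
Qed.

(** The 3 accounts for the counting sweep and the final placing sweep of each graph. *)
Lemma reduction_sweeps (G H : graph) :
  sweeps (Count : sw_state S) (pair_cells G H 0 0)
    (terminate Slash
       [:: nseq (size (pair_cells G H 0 0)) (Bit true);
           terminate Bar [seq diag_word (vertex_entries G H false u) | u <- iota 0 (order G)];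
           terminate Bar [seq diag_word (vertex_entries G H true u) | u <- iota 0 (order H)]])
    ((order G + order H) * (size (pair_cells G H 0 0)).+1 + 3).
Proof.
have pos0 := with_position0 0 (pair_cells_position G H 0 0).
have second := @side_sweeps G H true 0 (order H) 0 [::] 0 (add0n _) (conj erefl erefl).
have first := @side_sweeps G H false 0 (order G) 0 _ _ (add0n _).
rewrite /side_cells pos0 in second; rewrite /side_cells pos0 in first.
have {first second} := first _ _ second => run.
have count c : [/\ sweep_state (Count : sw_state S) c = Count,
    sweep_write (Count : sw_state S) c = c
  & sweep_emit (Count : sw_state S) c = nseq (size c) (Bit true)].
  by elim: c => //= -[a [[r h] i]] c [st wr em]; rewrite st wr em.
have [st wr em] := count (pair_cells G H 0 0).
have := @SweepsNext S Count (pair_cells G H 0 0) (place_start false true).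
rewrite st em wr => /(_ _ _ erefl run); rewrite /terminate /=.
by rewrite -!cats1 -!catA /= mulnDl -addnA !addnS !addn0.
Qed.

Lemma phase_emit_size (q : phase) (c : marked_cell) :
  (size (phase_emit q c) <= (maxn (size s0) (size s1)).+2)%N.
Proof.
case: q => [|g act col0 row col over|g last here] //=.
  by case: c.1 => //=; rewrite size_nseq; case: (_ && _).
by rewrite size_rcons size_map; case: (_ && _); lia.
Qed.

Lemma phase_close_size (q : phase) :
  (size (phase_close q) <= (maxn (size s0) (size s1)).+2)%N.
Proof. by case: q => [|g act col0 row col over|g [] here]. Qed.

End ReductionSweeper.

(** * The reduction and its correctness *)

Section LacReduction.

Variable F : fieldType.

Definition cell_weights (G H : graph) (g : bool) :
    'M[F]_(size (pair_cells G H 0 0), order (side_graph G H g)) :=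
  \matrix_(i, u) (nth false (vertex_entries G H g u) i)%:R.

Definition lac_of_graphs (GH : graph * graph) : lac_instance F :=
  LacInstance (diag_basis (cell_weights GH.1 GH.2 false))
              (diag_basis (cell_weights GH.1 GH.2 true)).

(** The weights stand in reading order; the zero ending each row belongs to its [Semi]. *)
Definition graph_weights (G : graph) : seq 'rV[F]_(order G) :=
  flatten [seq rcons [seq graph_weight F (x, y) | y <- enum 'I_(order G)] 0
          | x <- enum 'I_(order G)].

Lemma graph_weights_perm (G : graph) :
  perm_eq (graph_weights G)
    ([seq graph_weight F p | p <- enum predT] ++ nseq (order G) 0).
Proof.
have perm_rcons (I : Type) (T : eqType) (f : I -> seq T) a xs :
    perm_eq (flatten [seq rcons (f x) a | x <- xs])
            (flatten [seq f x | x <- xs] ++ nseq (size xs) a).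
  elim: xs => //= x xs IHxs; rewrite -cats1 -!catA perm_cat2l.
  by rewrite perm_sym (perm_catCA _ [:: a] (nseq (size xs) a)) perm_cat2l perm_sym.
apply: perm_trans (perm_rcons _ _ _ _ _) _.
rewrite size_enum_ord perm_cat2r.
rewrite -(map_allpairs (@graph_weight F G) (fun x y => (x, y))); apply: perm_map.
apply: uniq_perm; first by rewrite allpairs_uniq ?enum_uniq // => -[? ?] [? ?].
  exact: enum_uniq.
move=> [x y]; rewrite mem_enum inE; apply/allpairsP.
by exists (x, y); rewrite !mem_enum.
Qed.

Lemma graph_cells_weights (G : graph) (u : 'I_(order G)) :
  [seq (cell_entry c)%:R | c <- graph_cells G u.+1]
  = [seq t 0 u | t : 'rV[F]_(order G) <- graph_weights G].
Proof.
have entry_weight (x y : 'I_(order G)) :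
    (cell_entry (Bit (adj x y), (x.+1 == u.+1, y.+1 == u.+1, false)))%:R
    = graph_weight F (x, y) 0 u.
  rewrite /graph_weight /= !eqSS !val_eqE; case: (adj x y) => /=.
    by rewrite pair_weightE ![u == _]eq_sym orb_andl; case: (x == u); case: (y == u).
  (* Off the edges the entry is 1 only for x = y = u. *)
  have [<-|xy] := eqVneq x y; first by rewrite pair_weightE eq_sym orbb andbb orbF.
  rewrite mxE; have [xu|] := eqVneq x u; have [yu|] := eqVneq y u => //.
  by rewrite xu yu eqxx in xy.
have row_weights r (x : 'I_(order G)) ys : r = (x.+1 == u.+1) ->
    [seq (cell_entry c)%:R | c <- row_cells u.+1 r x ys]
    = [seq t 0 u | t : 'rV[F]_(order G) <- rcons [seq graph_weight F (x, y) | y <- ys] 0].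
  move=> ->; elim: ys => [|y ys IHys]; first by rewrite /= mxE.
  by rewrite /= -entry_weight; congr (_ :: _).
suff rows_weights xs : [seq (cell_entry c)%:R | c <- rows_cells u.+1 xs]
    = [seq t 0 u | t : 'rV[F]_(order G) <-
        flatten [seq rcons [seq graph_weight F (x, y) | y <- enum 'I_(order G)] 0 | x <- xs]].
  exact: rows_weights.
elim: xs => // x xs IHxs.
by rewrite /rows_cells /= !map_cat row_weights // IHxs.
Qed.

Lemma graph_cells_unmarked (G : graph) :
  [seq (cell_entry c)%:R | c <- graph_cells G 0] = nseq (size (graph_cells G 0)) 0 :> seq F.
Proof.
have row_unmarked (x : 'I_(order G)) ys :
    [seq (cell_entry c)%:R | c <- row_cells 0 false x ys]
    = nseq (size (row_cells 0 false x ys)) 0 :> seq F.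
  by elim: ys => //= y ys ->; rewrite andbF.
rewrite /graph_cells; elim: (enum _) => // x xs IHxs.
by rewrite /rows_cells /= map_cat size_cat nseqD row_unmarked; congr (_ ++ _).
Qed.

Lemma cell_weights_graph (G H : graph) g : weight_matrix_of (cell_weights G H g).
Proof.
set K := side_graph G H g.
(* The other graph and the slashes contribute zeros, [m1] of them before the graph and [m2] after
   it. *)
pose m1 := if g then (size (graph_cells G 0) + 1)%N else 0%N.
pose m2 := if g then 1%N else (1 + (size (graph_cells H 0) + 1))%N.
pose L : seq 'rV[F]_(order K) := nseq m1 0 ++ graph_weights K ++ nseq m2 0.
have LE (u : 'I_(order K)) :
    [seq b%:R | b : bool <- vertex_entries G H g u] = [seq t 0 u | t : 'rV[F]_(order K) <- L].
  rewrite -[LHS]map_comp /vertex_entries /L /m1 /m2 /side_cells !map_cat !map_nseq mxE.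
  clear L m1 m2; move: u; rewrite {}/K; case: g => u /=.
    by rewrite !map_cat /= map_cat graph_cells_unmarked -graph_cells_weights nseqD -catA.
  by rewrite map_cat /= map_cat graph_cells_unmarked -graph_cells_weights !nseqD.
have size_weights J : size (graph_weights J) = size (graph_cells J 0).
  rewrite /graph_weights /graph_cells /rows_cells.
  suff rows_size (xs : seq 'I_(order J)) :
    size (flatten [seq rcons [seq graph_weight F (x, y) | y <- enum 'I_(order J)] 0 | x <- xs])
      = size (rows_cells 0 xs) by exact: rows_size.
  by elim: xs => //= x xs; rewrite !size_cat !size_rcons !size_map => ->.
have sizeL : size L = size (pair_cells G H 0 0).
  rewrite !size_cat !size_nseq size_weights /= size_cat /=.
  by rewrite /m1 /m2 /K; case: (g) => /=; lia.
exists (order K + m1 + m2)%N.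
rewrite (_ : [seq row i _ | i <- _] = L).
  rewrite /L perm_catC -catA.
  apply: perm_trans (perm_cat (graph_weights_perm K) (perm_refl _)) _.
  by rewrite -catA perm_cat2l -!nseqD -addnA (addnC m2) perm_refl.
apply: (@eq_from_nth _ 0); first by rewrite size_map size_enum_ord.
move=> i; rewrite size_map size_enum_ord => lt_i.
rewrite (nth_map (Ordinal lt_i)) ?size_enum_ord //; apply/rowP => u.
have := congr1 (nth 0 ^~ i) (LE u).
rewrite (nth_map false) ?size_map ?size_side_cells // (nth_map 0) ?sizeL // => <-.
by rewrite !mxE nth_enum_ord.
Qed.

(** All entries are 0 or 1, so one fixed representation of each suffices over any field. *)
Definition diag_code (s0 s1 : seq bool) N (d : seq bool) : 'M[seq bool]_N :=
  \matrix_(i, j) if (j == i) && nth false d j then s1 else s0.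

Lemma diag_code_word s0 s1 (d : seq bool) N :
  size d = N -> matrix_word (diag_code s0 s1 N d) = diag_word s0 s1 d.
Proof.
move=> dN; rewrite /matrix_word /diag_word /diag_row_word; congr terminate.
rewrite dN -[in RHS]val_enum_ord -[RHS]map_comp; apply: eq_map => i /=.
rewrite val_enum_ord; congr terminate.
apply: (@eq_from_nth _ [::]) => [|j].
  by rewrite size_map size_enum_ord size_map size_zip size_iota dN minnn.
rewrite size_map size_enum_ord => lt_j.
rewrite (nth_map (Ordinal lt_j)) ?size_enum_ord //.
rewrite (nth_map (0%N, false)) ?size_zip ?size_iota ?dN ?minnn //.
rewrite nth_zip ?size_iota // nth_iota // /entry_word !mxE /= nth_enum_ord //.
by rewrite -val_eqE /= nth_enum_ord.
Qed.

Lemma lac_of_graphs_code (rep : seq bool -> option F) s0 s1 (G H : graph) :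
    rep s0 = Some 0 -> rep s1 = Some 1 ->
  lac_code rep
    (terminate Slash
       [:: nseq (size (pair_cells G H 0 0)) (Bit true);
           terminate Bar [seq diag_word s0 s1 (vertex_entries G H false u) | u <- iota 0 (order G)];
           terminate Bar [seq diag_word s0 s1 (vertex_entries G H true u) | u <- iota 0 (order H)]])
    (lac_of_graphs (G, H)).
Proof.
move=> rep0 rep1.
pose codes g := [seq diag_code s0 s1 (size (pair_cells G H 0 0)) (vertex_entries G H g u)
                | u : 'I_(order (side_graph G H g)) <- enum 'I_(order (side_graph G H g))].
have codes_rep g : [seq map_mx rep C | C <- codes g]
    = [seq map_mx Some B | B <- diag_basis (cell_weights G H g)].
  rewrite /codes /diag_basis -!map_comp; apply: eq_map => u; apply/matrixP => i j.
  rewrite !mxE [j == i]eq_sym; case: eqP => [->|_] /=; last by rewrite mulr0n.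
  by rewrite mulr1n; case: nth.
have codes_word g : [seq matrix_word C | C <- codes g]
    = [seq diag_word s0 s1 (vertex_entries G H g u) | u <- iota 0 (order (side_graph G H g))].
  rewrite /codes -val_enum_ord -[LHS]map_comp -[RHS]map_comp; apply: eq_map => u /=.
  by rewrite diag_code_word // size_map size_side_cells.
exists (codes false), (codes true); split; [exact: codes_rep | exact: codes_rep |].
by rewrite !codes_word.
Qed.

Lemma lac_of_graphs_promise (rep : seq bool -> option F) GH :
  spromise (lac_of_graphs GH : sinst (abelian_diagonalizable_LAC rep)).
Proof.
by split; apply: diag_basis_abelian_diagonalizable; apply/row_vertex/cell_weights_graph.
Qed.

Lemma lac_of_graphs_conjugate GH :
  (exists A, conjugates A (lac_alg1 (lac_of_graphs GH)) (lac_alg2 (lac_of_graphs GH))) <->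
  graph_iso GH.1 GH.2.
Proof.
exact: (conjugate_weights_graph_iso (cell_weights_graph GH.1 GH.2 false)
                                    (cell_weights_graph GH.1 GH.2 true)).
Qed.

End LacReduction.

(** Every row contributes at least its [Semi], and the slashes make the inequality strict. *)
Lemma order_lt_pair_cells (G H : graph) :
  (order G + order H < size (pair_cells G H 0 0))%N.
Proof.
have order_rows (K : graph) (xs : seq 'I_(order K)) : (size xs <= size (rows_cells 0 xs))%N.
  by elim: xs => //= x xs IHxs; rewrite size_cat size_rcons addSn ltnS;
    apply: leq_trans IHxs (leq_addl _ _).
have := order_rows G (enum 'I_(order G)); have := order_rows H (enum 'I_(order H)).
rewrite !size_enum_ord => leH leG.
rewrite !size_cat /= size_cat addnS ltnS leq_add //.
exact: leq_trans leH (leq_addr _ _).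
Qed.

Theorem corollary2p3 (F : fieldType) (rep : seq bool -> option F)
    (rep0 : exists s : seq bool, rep s = Some 0)
    (rep1 : exists s : seq bool, rep s = Some 1) :
  GI_hard (abelian_diagonalizable_LAC rep).
Proof.
have [s0 s0P] := rep0; have [s1 s1P] := rep1.
(* The 2 leaves room for the comma after an entry and for the closing word, which has at most two
   symbols. *)
pose K := (maxn (size s0) (size s1)).+2.
exists (@lac_of_graphs F) => [|GH]; last first.
  split=> [|ans]; first exact: lac_of_graphs_promise.
  rewrite /= -(lac_of_graphs_conjugate F GH); case: ans => [A|] /= ansP.
    by split=> // _; exists A.
  by split=> // -[A /ansP].
(* For input length N there are fewer than N vertices, hence at most (N+1)^2 sweeps, each of at most
   (K+2)(N+1) steps. *)
exists (@sweeper_machine (reduction_sweeper s0 s1) Count K), (K.+2%:P * ('X + 1) ^+ 3).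
move=> [G H] _ ->; eexists; first exact: lac_of_graphs_code s0P s1P.
have run := reduction_sweeps s0 s1 G H; rewrite -map_unmarked_pair in run.
have [t t_le] := @sweeper_machine_outputs (reduction_sweeper s0 s1) Count K
  (phase_emit_size s0 s1) (phase_close_size s0 s1) _ _ _ run.
rewrite -map_unmarked_pair; exists t => //; apply: leq_trans t_le _.
rewrite hornerM horner_exp hornerD hornerX !hornerC.
have := order_lt_pair_cells G H; rewrite -map_unmarked_pair size_map.
set N := size _ => lt_N.
rewrite -[X in (_ <= X)%N]/(K.+2 * ((N + 1) * ((N + 1) * (N + 1))))%N addn1.
rewrite mulnC -mulnA leq_mul2l mulnC mulnA leq_mul2r; apply/orP; right; apply/orP; right.
by move: (order G + order H)%N N lt_N => a N' lt_N'; nia.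
Qed.
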